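(* Let $\mathcal{C}:[0,1]\to\mathbb{R}^3$ be a compact, regular, $C^2$, simple, parametric space curve, and let $\{C_i\}_{i=1}^{\infty}$ be a sequence of piecewise $C^2$ parametric curves $C_i:[0,1]\to\mathbb{R}^3$. If $\{C_i\}_{i=1}^\infty$ converges pointwise to $\mathcal{C}$, then for every $\epsilon>0$ there exists an integer $N$ such that $T_\kappa(C_i)>T_\kappa(\mathcal{C})-\epsilon$ for all $i\ge N$.
   Context: Curves. All curves are continuous maps $[0,1]\to\mathbb{R}^3$. A curve $\gamma$ is closed if $\gamma(0)=\gamma(1)$, and open otherwise. A curve is simple if it is injective on $[0,1]$ (open case), or injective on $[0,1)$ with $\gamma(0)=\gamma(1)$ (closed case). Regular means that the derivative never vanishes. A closed curve is called regular and $C^2$ if its periodic extension is. If $\mathcal{C}$ is closed, the approximating curves $C_i$ are understood to be closed as well. Piecewise $C^2$. A curve $\gamma$ is piecewise $C^2$ if there is a finite partition of $[0,1]$ such that $\gamma$ restricted to each closed subinterval is $C^2$ with nowhere vanishing (one-sided at the ends) derivative. Total curvature. The exterior angle of $\gamma$ at a breakpoint $t_i$ is the angle in $[0,\pi]$ between the one-sided derivatives $\gamma'(t_i-)$ and $\gamma'(t_i+)$. The total curvature $T_\kappa(\gamma)$ is the sum of the integrals $\int|\kappa(s)|\,ds$ (with $s$ arc length and $\kappa$ the curvature) over the $C^2$ pieces plus the sum of the exterior angles at the breakpoints, including the closing point if $\gamma$ is closed. $\{C_i\}$ converges pointwise to $\mathcal{C}$ if $C_i(t)\to\mathcal{C}(t)$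 for every $t\in[0,1]$. *)

(* Defs.v *)
From Stdlib Require Import Reals Psatz ClassicalEpsilon.
From Coquelicot Require Import Coquelicot.

Open Scope R_scope.

(* Coquelicot's norm on a product is the square root of the sum of the squared
   norms, so [norm] on [E3] is the Euclidean norm: see [norm_E3]. *)
Definition E3 : NormedModule R_AbsRing :=
  prod_NormedModule R_AbsRing
    (prod_NormedModule R_AbsRing R_NormedModule R_NormedModule) R_NormedModule.

Definition dot (u v : E3) : R :=
  fst (fst u) * fst (fst v) + snd (fst u) * snd (fst v) + snd u * snd v.

Lemma norm_E3 (u : E3) : norm u = sqrt (dot u u).
Proof.
destruct u as [[x y] z].
change (sqrt (sqrt (Rabs x ^ 2 + Rabs y ^ 2) ^ 2 + Rabs z ^ 2)
        = sqrt (x * x + y * y + z * z)).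
rewrite !pow2_abs, pow2_sqrt; [f_equal; ring | nra].
Qed.

Definition angle (u v : E3) : R := acos (dot u v / (norm u * norm v)).

Definition cc (a b : R) : R -> Prop := fun t => a <= t <= b.
Definition co (a b : R) : R -> Prop := fun t => a <= t < b.

(* Derivative relative to a set [D]: Coquelicot's [is_derive] with [locally x]
   replaced by its trace on [D].  At an end point of an interval [D] this is
   the one-sided derivative. *)
Definition is_derive_within (D : R -> Prop) (f : R -> E3) (x : R) (l : E3) :
    Prop :=
  filterdiff f (within D (locally x)) (fun h : R => scal h l).

Definition ex_derive_within (D : R -> Prop) (f : R -> E3) (x : R) : Prop :=
  exists l : E3, is_derive_within D f x l.

Definition derive_within (D : R -> Prop) (f : R -> E3) (x : R) : E3 :=
  epsilon (inhabits zero) (is_derive_within D f x).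

Definition C2_on (D : R -> Prop) (g : R -> E3) : Prop :=
  (forall t, D t -> ex_derive_within D g t) /\
  (forall t, D t -> ex_derive_within D (derive_within D g) t) /\
  continuous_on D (derive_within D (derive_within D g)).

Definition regular_on (D : R -> Prop) (g : R -> E3) : Prop :=
  forall t, D t -> derive_within D g t <> zero.

(* Curves are functions on [R] of which only the values on [0,1] matter. *)
Definition is_curve (g : R -> E3) : Prop := continuous_on (cc 0 1) g.

Definition closed_curve (g : R -> E3) : Prop := g 0 = g 1.

Definition injective_on (D : R -> Prop) (g : R -> E3) : Prop :=
  forall s t, D s -> D t -> g s = g t -> s = t.

Definition simple_curve (g : R -> E3) : Prop :=
  (closed_curve g -> injective_on (co 0 1) g) /\
  (~ closed_curve g -> injective_on (cc 0 1) g).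

Definition periodic_extension (g : R -> E3) : R -> E3 :=
  fun t => g (frac_part t).

Definition C2_curve (g : R -> E3) : Prop :=
  (closed_curve g -> C2_on (fun _ => True) (periodic_extension g)) /\
  (~ closed_curve g -> C2_on (cc 0 1) g).

Definition regular_curve (g : R -> E3) : Prop :=
  (closed_curve g -> regular_on (fun _ => True) (periodic_extension g)) /\
  (~ closed_curve g -> regular_on (cc 0 1) g).

Definition is_partition (n : nat) (t : nat -> R) : Prop :=
  t 0%nat = 0 /\ t n = 1 /\ forall k : nat, (k < n)%nat -> t k < t (S k).

Definition piecewise_C2_for (n : nat) (t : nat -> R) (g : R -> E3) : Prop :=
  is_partition n t /\
  forall k : nat, (k < n)%nat ->
    C2_on (cc (t k) (t (S k))) g /\ regular_on (cc (t k) (t (S k))) g.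

Definition piecewise_C2 (g : R -> E3) : Prop :=
  exists (n : nat) (t : nat -> R), piecewise_C2_for n t g.

Definition speed (D : R -> Prop) (g : R -> E3) (t : R) : R :=
  norm (derive_within D g t).

Definition unit_tangent (D : R -> Prop) (g : R -> E3) (t : R) : E3 :=
  scal (/ speed D g t) (derive_within D g t).

(* |dT/ds| for the unit tangent T and the arc length s, with ds = speed dt. *)
Definition curvature (D : R -> Prop) (g : R -> E3) (t : R) : R :=
  norm (derive_within D (unit_tangent D g) t) / speed D g t.

(* The integral of |curvature| with respect to arc length over [a,b]. *)
Definition piece_curvature (g : R -> E3) (a b : R) : R :=
  RInt (fun t => Rabs (curvature (cc a b) g t) * speed (cc a b) g t) a b.

Definition left_derivative (g : R -> E3) (t : R) : E3 :=
  derive_within (fun s => s <= t) g t.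

Definition right_derivative (g : R -> E3) (t : R) : E3 :=
  derive_within (fun s => t <= s) g t.

Definition exterior_angle (g : R -> E3) (t : R) : R :=
  angle (left_derivative g t) (right_derivative g t).

Definition closing_angle (g : R -> E3) : R :=
  if excluded_middle_informative (closed_curve g)
  then angle (left_derivative g 1) (right_derivative g 0)
  else 0.

(* A sum from 1 to 0 (case n = 1) is empty. *)
Definition total_curvature_for (n : nat) (t : nat -> R) (g : R -> E3) : R :=
  sum_n_m (fun k => piece_curvature g (t k) (t (S k))) 0 (pred n)
  + sum_n_m (fun k => exterior_angle g (t k)) 1 (pred n)
  + closing_angle g.

(* The value does not depend on the partition: at a superfluous breakpoint the
   exterior angle is 0. *)
Definition is_total_curvature (g : R -> E3) (T : R) : Prop :=
  exists (n : nat) (t : nat -> R),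
    piecewise_C2_for n t g /\ T = total_curvature_for n t g.

Definition total_curvature (g : R -> E3) : R :=
  epsilon (inhabits 0) (is_total_curvature g).

Definition converges_pointwise (G : nat -> R -> E3) (g : R -> E3) : Prop :=
  forall t, 0 <= t <= 1 -> filterlim (fun i => G i t) eventually (locally (g t)).

(* Main.v *)
Require Import Defs.
From Stdlib Require Import Reals Psatz Classical ClassicalEpsilon.
From Coquelicot Require Import Coquelicot.
Open Scope R_scope.

(** Total curvature is the length of the path traced by the unit tangent on the
sphere, a corner contributing the minor great arc between its two tangents.
The lower semicontinuity under mere pointwise convergence rests on Milnor's
observation that curvature controls secants, which only depend on the
positions of finitely many points.

The geometric input is the triangle inequality for [angle] ([angle_triangle])
and its equality case: a sum [u + w] lies on the minor great arc from [u] to [w]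
([angle_plus]).  They show that if [v] is a nonzero nonnegative combination of
successive directions [u_1, ..., u_n], then going from [u_1] to [u_n] through [v]
is no longer than the spherical polygon through the [u_i].  Velocities of a
smooth arc satisfy this in the limit, because the displacement along the arc is
a limit of Riemann sums of the velocity ([smooth_arc_chord]), and the property
passes through corners ([angle_chord_concat]).  Hence an arc of total curvature
[K] from [a] to [b] has [angle (g p - g a) (g b - g q) <= K] whenever
[a < p < q < b] and both secants are nonzero ([angle_two_chords]).

On a short interval [s,t] the total curvature of the smooth limit curve is, up
to an error small compared with [t - s], the angle between its tangents at [s]
and [t] ([angle_turning_approx]), hence nearly the angle between a short secant
issued from [s] and one arriving at [t].  Pointwise convergence makes the same
secants of the approximating curves converge, so that their total curvature on
[s,t] is eventually at least as large up to a small error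
([arc_curvature_liminf_tangents]).  Adding over finitely many short intervals
bounds the total curvature on [0,1] ([arc_curvature_liminf]).  Closing angles
are harmless: that of a regular C2 closed curve vanishes, and those of the
approximating curves can only increase the total.

Smooth arcs are handled through extensions that are differentiable in the
ordinary sense also at the end points ([arc_chart]), and piecewise smooth ones
through [arc_curvature], which is generated by smooth arcs and concatenation and
therefore can be cut at any interior point ([arc_curvature_split]). *)

(** * Euclidean geometry of the tangent directions *)

Lemma dot_sym (u v : E3) : dot u v = dot v u.
Proof. unfold dot; ring. Qed.

Lemma dot_plus_l (u v w : E3) : dot (plus u v) w = dot u w + dot v w.
Proof.
destruct u as [[]], v as [[]], w as [[]]; unfold dot, plus; simpl.
unfold plus; simpl; ring.
Qed.

Lemma dot_scal_l (k : R) (u w : E3) : dot (scal k u) w = k * dot u w.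
Proof.
destruct u as [[]], w as [[]]; unfold dot, scal; simpl.
unfold scal; simpl; unfold mult; simpl; ring.
Qed.

Lemma dot_minus_l (u v w : E3) : dot (minus u v) w = dot u w - dot v w.
Proof.
destruct u as [[]], v as [[]], w as [[]]; unfold dot, minus, plus, opp; simpl.
unfold plus, opp; simpl; ring.
Qed.

Lemma dot_plus_r (u v w : E3) : dot w (plus u v) = dot w u + dot w v.
Proof. rewrite !(dot_sym w); apply dot_plus_l. Qed.

Lemma dot_scal_r (k : R) (u w : E3) : dot w (scal k u) = k * dot w u.
Proof. rewrite !(dot_sym w); apply dot_scal_l. Qed.

Lemma dot_minus_r (u v w : E3) : dot w (minus u v) = dot w u - dot w v.
Proof. rewrite !(dot_sym w); apply dot_minus_l. Qed.

Lemma dot_self_ge_0 (u : E3) : 0 <= dot u u.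
Proof. unfold dot; nra. Qed.

Lemma norm_mult_self (u : E3) : norm u * norm u = dot u u.
Proof. rewrite norm_E3; apply sqrt_sqrt, dot_self_ge_0. Qed.

Lemma norm_gt_0 (u : E3) : u <> zero -> 0 < norm u.
Proof.
intros Hu; destruct (norm_ge_0 u) as [H | H]; [exact H |].
exfalso; apply Hu, norm_eq_zero; now symmetry.
Qed.

Lemma norm_scal_E3 (k : R) (u : E3) : norm (scal k u) = Rabs k * norm u.
Proof.
rewrite !norm_E3, dot_scal_l, dot_scal_r, <- Rmult_assoc.
rewrite (sqrt_mult_alt (k * k)) by apply Rle_0_sqr.
f_equal; apply sqrt_Rsqr_abs.
Qed.

Lemma dot_sqr_le (u v : E3) : Rsqr (dot u v) <= dot u u * dot v v.
Proof.
destruct u as [[a b] c], v as [[x y] z]; unfold dot, Rsqr; simpl.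
(* Lagrange's identity: the difference is the squared cross product. *)
pose proof (Rle_0_sqr (a * y - b * x)); pose proof (Rle_0_sqr (b * z - c * y)).
pose proof (Rle_0_sqr (c * x - a * z)); unfold Rsqr in *; lra.
Qed.

Lemma dot_le_norm (u v : E3) : Rabs (dot u v) <= norm u * norm v.
Proof.
rewrite !norm_E3, <- sqrt_mult_alt by apply dot_self_ge_0.
rewrite <- sqrt_Rsqr_abs; apply sqrt_le_1_alt, dot_sqr_le.
Qed.

Lemma angle_sym (u v : E3) : angle u v = angle v u.
Proof. unfold angle; now rewrite dot_sym, (Rmult_comm (norm u)). Qed.

Lemma angle_bound (u v : E3) : 0 <= angle u v <= PI.
Proof. apply acos_bound. Qed.

Lemma cosine_bound (u v : E3) : -1 <= dot u v / (norm u * norm v) <= 1.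
Proof.
pose proof (dot_le_norm u v) as H.
pose proof (norm_ge_0 u) as Hu; pose proof (norm_ge_0 v) as Hv.
apply Rabs_le_between.
destruct (Req_dec (norm u * norm v) 0) as [E | E].
- rewrite E; unfold Rdiv; rewrite Rinv_0, Rmult_0_r, Rabs_R0; lra.
- assert (P : 0 < norm u * norm v) by nra.
  rewrite Rabs_div, (Rabs_pos_eq (norm u * norm v)) by lra.
  apply Rle_div_l; lra.
Qed.

Lemma cos_angle (u v : E3) : cos (angle u v) = dot u v / (norm u * norm v).
Proof. apply cos_acos, cosine_bound. Qed.

Lemma dot_angle (u v : E3) : dot u v = norm u * norm v * cos (angle u v).
Proof.
rewrite cos_angle.
destruct (Req_dec (norm u * norm v) 0) as [E | E]; [| field; nra].
pose proof (dot_le_norm u v) as H; rewrite E in *.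
pose proof (Rabs_pos (dot u v)).
unfold Rdiv; rewrite Rmult_0_l.
destruct (Req_dec (dot u v) 0) as [F | F]; [exact F |].
pose proof (Rabs_no_R0 _ F); lra.
Qed.

Lemma cos_le_inv (x y : R) :
  0 <= x <= PI -> 0 <= y <= PI -> cos y <= cos x -> x <= y.
Proof.
intros Hx Hy H; apply Rnot_lt_le; intros L.
pose proof (cos_decreasing_1 y x); lra.
Qed.


Lemma angle_scal_l (k : R) (u v : E3) :
  0 < k -> angle (scal k u) v = angle u v.
Proof.
intros Hk; unfold angle; rewrite dot_scal_l, norm_scal_E3, Rabs_pos_eq by lra.
f_equal; unfold Rdiv; rewrite !Rinv_mult.
replace (_ * _) with (k * / k * (dot u v * (/ norm u * / norm v))) by ring.
now rewrite Rinv_r, Rmult_1_l by lra.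
Qed.

Lemma angle_scal_r (k : R) (u v : E3) :
  0 < k -> angle u (scal k v) = angle u v.
Proof.
intros Hk; rewrite angle_sym, angle_scal_l by exact Hk; apply angle_sym.
Qed.

Lemma angle_same (u : E3) : u <> zero -> angle u u = 0.
Proof.
intros Hu; pose proof (norm_gt_0 u Hu).
unfold angle; rewrite <- norm_mult_self.
replace (_ / _) with 1 by (field; lra).
apply acos_1.
Qed.

Lemma angle_zero_l (v : E3) : angle zero v = PI / 2.
Proof.
unfold angle; replace (dot zero v) with 0 by (unfold dot; simpl; unfold zero; simpl; ring).
unfold Rdiv at 1; rewrite Rmult_0_l; apply acos_0.
Qed.

(** The difference of the two sides is [dot v v] times the Gram determinant of
[u], [v], [w], which is a squared determinant. *)
Lemma gram_ge_0 (u v w : E3) :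
  Rsqr (dot u w * dot v v - dot u v * dot v w)
  <= (dot u u * dot v v - Rsqr (dot u v)) * (dot v v * dot w w - Rsqr (dot v w)).
Proof.
destruct u as [[a b] c], v as [[x y] z], w as [[p q] r]; unfold dot, Rsqr; simpl.
set (d := a * (y * r - z * q) - b * (x * r - z * p) + c * (x * q - y * p)).
apply Rminus_le_0.
match goal with |- 0 <= ?e =>
  replace e with ((x * x + y * y + z * z) * (d * d)) by (unfold d; ring) end.
nra.
Qed.

Lemma sin_angle_mult (u v : E3) :
  norm u * norm v * sin (angle u v) = sqrt (dot u u * dot v v - Rsqr (dot u v)).
Proof.
pose proof (norm_ge_0 u); pose proof (norm_ge_0 v).
assert (0 <= sin (angle u v)) by (apply sin_ge_0; apply angle_bound).
rewrite <- (sqrt_Rsqr (norm u * norm v * _)) by (apply Rmult_le_pos; nra).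
f_equal; rewrite (dot_angle u v), <- !norm_mult_self, !Rsqr_mult, sin2.
unfold Rsqr; ring.
Qed.

(** Spherical triangle inequality.  With [cos (angle u w)] expanded relative to
[v], it says that the components of [u] and [w] orthogonal to [v] obey
Cauchy-Schwarz, which is [gram_ge_0].  It extends to zero vectors because these make
the angle [PI / 2] with every vector. *)
Lemma angle_triangle (u v w : E3) : angle u w <= angle u v + angle v w.
Proof.
destruct (angle_bound u v) as [A0 A1], (angle_bound v w) as [B0 B1].
destruct (angle_bound u w) as [C0 C1].
destruct (Rle_lt_dec PI (angle u v + angle v w)) as [L | L]; [lra |].
destruct (classic (u = zero)) as [-> | Hu]; [rewrite !angle_zero_l in *; lra |].
destruct (classic (w = zero)) as [-> | Hw];
  [rewrite (angle_sym u), (angle_sym v), !angle_zero_l in *; lra |].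
destruct (classic (v = zero)) as [-> | Hv];
  [rewrite (angle_sym u zero), !angle_zero_l in *; lra |].
apply norm_gt_0 in Hu, Hv, Hw.
apply cos_le_inv; [lra | lra |].
rewrite cos_plus.
apply Rmult_le_reg_l with (norm u * norm w * (norm v * norm v)).
{ repeat apply Rmult_lt_0_compat; assumption. }
replace (norm u * norm w * (norm v * norm v) * cos (angle u w))
  with (dot u w * dot v v) by (rewrite (dot_angle u w), <- norm_mult_self; ring).
replace (norm u * norm w * (norm v * norm v) * _)
  with (dot u v * dot v w
        - norm u * norm v * sin (angle u v) * (norm v * norm w * sin (angle v w)))
  by (rewrite (dot_angle u v), (dot_angle v w); ring).
rewrite !sin_angle_mult.
assert (P : forall x y : E3, 0 <= dot x x * dot y y - Rsqr (dot x y))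
  by (intros x y; pose proof (dot_sqr_le x y); lra).
rewrite <- sqrt_mult by apply P.
pose proof (gram_ge_0 u v w) as G.
apply sqrt_le_1_alt in G; rewrite sqrt_Rsqr_abs in G.
apply Rabs_le_between in G; lra.
Qed.

(** A sum of two vectors lies on the minor great arc between them: relative to
the sum their orthogonal components are opposite, so Cauchy-Schwarz is an equality
in the computation behind the triangle inequality. *)
Lemma angle_plus (u w : E3) :
  u <> zero -> w <> zero -> plus u w <> zero ->
  angle u (plus u w) + angle (plus u w) w <= angle u w.
Proof.
intros Hu Hw Hv.
apply norm_gt_0 in Hu, Hw, Hv.
set (v := plus u w) in *.
destruct (angle_bound u v) as [A0 A1], (angle_bound v w) as [B0 B1].
destruct (angle_bound u w) as [C0 C1].
assert (Huv : dot u v = dot u u + dot u w) by apply dot_plus_r.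
assert (Hvw : dot v w = dot u w + dot w w) by apply dot_plus_l.
assert (Hvv : dot v v = dot u u + 2 * dot u w + dot w w).
{ unfold v; rewrite dot_plus_l, !dot_plus_r, (dot_sym w u); ring. }
(* without this bound the cosine would not determine the sum of the two angles *)
assert (S : angle u v + angle v w <= PI).
{ enough (angle u v <= PI - angle v w) by lra.
  apply cos_le_inv; [lra | lra |].
  rewrite Rtrigo_facts.cos_pi_minus.
  apply Rmult_le_reg_l with (norm u * norm v * norm w).
  { repeat apply Rmult_lt_0_compat; assumption. }
  replace (_ * - _) with (- norm u * dot v w) by (rewrite (dot_angle v w); ring).
  replace (norm u * norm v * norm w * _) with (norm w * dot u v) by (rewrite (dot_angle u v); ring).
  rewrite Huv, Hvw, <- !norm_mult_self.
  pose proof (dot_le_norm u w) as D; apply Rabs_le_between in D.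
  assert (0 <= (norm u + norm w) * (norm u * norm w + dot u w)) by (apply Rmult_le_pos; lra).
  lra. }
apply cos_le_inv; [lra | lra |].
rewrite cos_plus.
apply Rmult_le_reg_l with (norm u * norm w * (norm v * norm v)).
{ repeat apply Rmult_lt_0_compat; assumption. }
replace (norm u * norm w * (norm v * norm v) * cos (angle u w))
  with (dot u w * dot v v) by (rewrite (dot_angle u w), <- norm_mult_self; ring).
replace (norm u * norm w * (norm v * norm v) * _)
  with (dot u v * dot v w
        - norm u * norm v * sin (angle u v) * (norm v * norm w * sin (angle v w)))
  by (rewrite (dot_angle u v), (dot_angle v w); ring).
rewrite !sin_angle_mult, Huv, Hvw, Hvv.
(* both squared areas equal that of the parallelogram on [u] and [w] *)
replace (dot u u * _ - _) with (dot u u * dot w w - Rsqr (dot u w)) by (unfold Rsqr; ring).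
replace (_ * dot w w - Rsqr (dot u w + dot w w))
  with (dot u u * dot w w - Rsqr (dot u w)) by (unfold Rsqr; ring).
rewrite sqrt_sqrt; [unfold Rsqr; lra |].
pose proof (dot_sqr_le u w); lra.
Qed.

Definition unit_vector (u : E3) : E3 := scal (/ norm u) u.

Lemma norm_unit_vector (u : E3) : u <> zero -> norm (unit_vector u) = 1.
Proof.
intros Hu; apply norm_gt_0 in Hu; unfold unit_vector.
rewrite norm_scal_E3, Rabs_pos_eq; [field; lra |].
left; now apply Rinv_0_lt_compat.
Qed.

Lemma angle_unit_vector (u v : E3) : u <> zero -> v <> zero ->
  angle (unit_vector u) (unit_vector v) = angle u v.
Proof.
intros Hu Hv; unfold unit_vector.
rewrite angle_scal_l, angle_scal_r; [reflexivity | |];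
  now apply Rinv_0_lt_compat, norm_gt_0.
Qed.

Definition chord (u v : E3) : R := norm (minus (unit_vector v) (unit_vector u)).

Lemma chord_ge_0 (u v : E3) : 0 <= chord u v.
Proof. apply norm_ge_0. Qed.

Lemma sqr_chord (u v : E3) : u <> zero -> v <> zero ->
  chord u v * chord u v = 2 - 2 * cos (angle u v).
Proof.
intros Hu Hv; unfold chord.
rewrite norm_mult_self, dot_minus_l, !dot_minus_r.
rewrite <- !norm_mult_self, !norm_unit_vector by assumption.
rewrite (dot_sym (unit_vector u)), (dot_angle (unit_vector v)).
rewrite !norm_unit_vector, angle_unit_vector, angle_sym by assumption; ring.
Qed.

Lemma one_minus_cos (x : R) : 1 - cos x = 2 * (sin (x / 2) * sin (x / 2)).
Proof.
replace (cos x) with (cos (2 * (x / 2))) by (f_equal; field).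
rewrite cos_2a_sin; ring.
Qed.

Lemma chord_le_angle (u v : E3) : u <> zero -> v <> zero ->
  chord u v <= angle u v.
Proof.
intros Hu Hv; pose proof (sqr_chord u v Hu Hv) as S.
pose proof (one_minus_cos (angle u v)) as O.
destruct (angle_bound u v) as [A0 A1].
pose proof (chord_ge_0 u v).
destruct A0 as [A0 | A0].
- assert (0 <= sin (angle u v / 2) <= angle u v / 2).
  { split; [apply sin_ge_0; lra | left; apply sin_lt_x; lra]. }
  nra.
- rewrite <- A0, cos_0 in S; nra.
Qed.

(** An arc exceeds its chord [c] by a quantity of order [c ^ 3]; the cruder
[c ^ 2] already makes sums over fine subdivisions converge to the same limit. *)
Lemma angle_le_chord (u v : E3) : u <> zero -> v <> zero -> chord u v <= 1 ->
  angle u v <= chord u v + chord u v * chord u v.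
Proof.
intros Hu Hv Hc; pose proof (sqr_chord u v Hu Hv) as S.
pose proof (chord_ge_0 u v) as H0; set (c := chord u v) in *.
assert (HP : 3 < PI) by (pose proof PI2_3_2; lra).
apply cos_le_inv; [apply angle_bound | nra |].
pose proof (one_minus_cos (c + c * c)) as O.
pose proof (sin_bound ((c + c * c) / 2) 0) as [B _]; [nra | nra |].
(* the bound is [sin y >= y - y ^ 3 / 6] *)
unfold sin_approx in B; simpl in B; unfold sin_term in B; simpl in B.
set (y := (c + c * c) / 2) in *.
assert (B' : y - y * y * y / 6 <= sin y) by (refine (Rle_trans _ _ _ _ B); right; field).
clear B.
enough (c / 2 <= y - y * y * y / 6) by nra.
assert (Hy : 0 <= y <= c) by (unfold y; nra).
assert (y * y * y <= c * c * c) by (apply Rmult_le_compat; nra).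
unfold y at 1 in H; unfold y at 1; nra.
Qed.

Ltac vector_ring :=
  repeat match goal with u : E3 |- _ => destruct u as [[? ?] ?] end;
  unfold minus, plus, opp, scal, zero; simpl;
  apply (f_equal2 pair); [apply (f_equal2 pair) |]; simpl;
  match goal with |- @eq _ ?x ?y => change (@eq R x y) end;
  unfold minus, plus, opp, scal, mult, zero; simpl; unfold mult; simpl; ring.

Lemma minus_scal_scal (a b : R) (u v : E3) :
  minus (scal b v) (scal a u) = plus (scal (b - a) v) (scal a (minus v u)).
Proof. vector_ring. Qed.

Lemma chord_le_dist (u v : E3) : u <> zero -> v <> zero ->
  chord u v <= 2 * norm (minus v u) / norm u.
Proof.
intros Hu Hv; apply norm_gt_0 in Hu, Hv.
unfold chord, unit_vector; rewrite minus_scal_scal.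
eapply Rle_trans; [apply (@norm_triangle R_AbsRing E3) |].
rewrite !norm_scal_E3, (Rabs_pos_eq (/ norm u)) by (left; now apply Rinv_0_lt_compat).
pose proof (@norm_triangle_inv R_AbsRing E3 v u) as T.
replace (/ norm v - / norm u) with (- (norm v - norm u) * / (norm v * norm u)) by (field; lra).
rewrite Rabs_mult, Rabs_Ropp, (Rabs_pos_eq (/ _)) by (left; apply Rinv_0_lt_compat; nra).
apply Rmult_le_reg_r with (norm u); [lra |].
replace (2 * norm (minus v u) / norm u * norm u) with (2 * norm (minus v u)) by (field; lra).
match goal with |- ?e <= _ =>
  replace e with (Rabs (norm v - norm u) + norm (minus v u)) by (field; lra) end.
lra.
Qed.

Lemma angle_near (u : E3) (eta : R) : u <> zero -> 0 < eta ->
  exists delta, 0 < delta /\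
    forall v, norm (minus v u) < delta -> v <> zero /\ angle u v <= eta.
Proof.
intros Hu He; pose proof (norm_gt_0 u Hu) as Pu.
set (m := Rmin 1 eta).
assert (Hm : 0 < m <= 1 /\ m <= eta).
{ unfold m; repeat split; [now apply Rmin_pos; lra | apply Rmin_l | apply Rmin_r]. }
exists (norm u * (m / 4)); split; [apply Rmult_lt_0_compat; lra |].
intros v Hd.
assert (Hv : v <> zero).
{ intros ->; rewrite <- norm_opp, opp_minus, minus_zero_r in Hd; nra. }
split; [exact Hv |].
assert (C : chord u v <= m / 2).
{ eapply Rle_trans; [now apply chord_le_dist |].
  apply Rle_div_l; [exact Pu |]; nra. }
pose proof (chord_ge_0 u v).
eapply Rle_trans; [apply angle_le_chord; [assumption .. | lra] | nra].
Qed.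

Lemma angle_continuous (u w : E3) (eta : R) :
  u <> zero -> w <> zero -> 0 < eta ->
  exists delta, 0 < delta /\
    forall u' w', norm (minus u' u) < delta -> norm (minus w' w) < delta ->
      u' <> zero /\ w' <> zero /\ Rabs (angle u' w' - angle u w) <= eta.
Proof.
intros Hu Hw He.
destruct (angle_near u (eta / 2)) as (d & Pd & Hd); [assumption | lra |].
destruct (angle_near w (eta / 2)) as (e & Pe & He'); [assumption | lra |].
exists (Rmin d e); split; [now apply Rmin_pos |].
intros u' w' Du Dw.
destruct (Hd u') as [Zu Au]; [eapply Rlt_le_trans; [exact Du | apply Rmin_l] |].
destruct (He' w') as [Zw Aw]; [eapply Rlt_le_trans; [exact Dw | apply Rmin_r] |].
repeat split; [assumption .. |].
pose proof (angle_triangle u u' w); pose proof (angle_triangle u' w' w).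
pose proof (angle_triangle u' u w'); pose proof (angle_triangle u w w').
rewrite (angle_sym u' u), (angle_sym w' w) in *.
apply Rabs_le_between; lra.
Qed.

(** * Increments of continuously differentiable curves *)

Lemma is_linear_dot (p : E3) :
  @is_linear R_AbsRing E3 R_NormedModule (fun u => dot p u).
Proof.
apply Build_is_linear.
- intros u v; apply dot_plus_r.
- intros k u; apply dot_scal_r.
- exists (norm p + 1); pose proof (norm_ge_0 p); split; [lra |].
  intros u; pose proof (dot_le_norm p u); pose proof (norm_ge_0 u).
  change (Rabs (dot p u) <= (norm p + 1) * norm u); nra.
Qed.

Lemma is_derive_dot (p : E3) (F : R -> E3) (t : R) (l : E3) :
  is_derive F t l -> is_derive (fun x => dot p (F x)) t (dot p l).
Proof.
intros D.
assert (L := filterdiff_comp (U := R_NormedModule) (V := E3) (W := R_NormedModule)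
  F (fun u => dot p u) _ (fun u => dot p u) D).
eapply filterdiff_ext_lin;
  [apply L, filterdiff_linear, is_linear_dot | intros y; apply dot_scal_r].
Qed.

(** The mean value theorem fails for vectors but holds for each projection;
choosing [p] after the increment is known turns this into norm estimates. *)
Lemma dot_mean_value (p : E3) (F F' : R -> E3) (s t : R) :
  s <= t -> (forall x, s <= x <= t -> is_derive F x (F' x)) ->
  exists x, s <= x <= t /\ dot p (minus (F t) (F s)) = (t - s) * dot p (F' x).
Proof.
intros Hst D.
destruct (MVT_gen (fun x => dot p (F x)) s t (fun x => dot p (F' x))) as (x & Hx & E);
  rewrite ?Rmin_left, ?Rmax_right in * by assumption.
- intros x Hx; apply is_derive_dot, D; lra.
- intros x Hx; apply continuity_pt_filterlim, (@ex_derive_continuous R_AbsRing R_NormedModule).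
  eexists; now apply is_derive_dot, D.
- exists x; split; [exact Hx |]; rewrite dot_minus_r, E; ring.
Qed.

Lemma increment_approx (F F' : R -> E3) (a b eps : R) :
  (forall x, a <= x <= b -> is_derive F x (F' x)) ->
  (forall x, a <= x <= b -> continuous F' x) ->
  0 < eps ->
  exists delta, 0 < delta /\
    forall s t, a <= s -> s <= t -> t <= b -> t - s < delta ->
      norm (minus (minus (F t) (F s)) (scal (t - s) (F' s))) <= eps * (t - s).
Proof.
intros D K He.
destruct (unifcont_normed_1d F' a b K (mkposreal eps He)) as [delta Hd].
exists delta; split; [apply cond_pos |].
intros s t Has Hst Htb Hlt.
set (w := minus (minus _ _) _).
destruct (dot_mean_value w F F' s t Hst) as (x & Hx & E); [intros; apply D; lra |].
assert (B : norm (minus (F' x) (F' s)) <= eps).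
{ left; apply (Hd s x); [lra | lra |].
  change (Rabs (x - s) < delta); rewrite Rabs_pos_eq; lra. }
(* the remainder [w] itself serves as the direction of projection *)
assert (Q : norm w * norm w <= (eps * (t - s)) * norm w).
{ rewrite norm_mult_self; unfold w at 2; rewrite dot_minus_r, E, dot_scal_r.
  rewrite <- Rmult_minus_distr_l, <- dot_minus_r.
  pose proof (dot_le_norm w (minus (F' x) (F' s))) as C; apply Rabs_le_between in C.
  pose proof (norm_ge_0 w).
  apply Rle_trans with ((t - s) * (norm w * eps)); [apply Rmult_le_compat_l; nra | lra]. }
destruct (norm_ge_0 w) as [P | P]; [nra | rewrite <- P; nra].
Qed.

Lemma RInt_approx (f : R -> R) (a b eps : R) :
  (forall x, a <= x <= b -> continuous f x) -> 0 < eps ->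
  exists delta, 0 < delta /\
    forall s t, a <= s -> s <= t -> t <= b -> t - s < delta ->
      Rabs (RInt f s t - (t - s) * f s) <= eps * (t - s).
Proof.
intros K He.
destruct (unifcont_normed_1d f a b K (mkposreal eps He)) as [delta Hd].
exists delta; split; [apply cond_pos |].
intros s t Has Hst Htb Hlt.
assert (I : ex_RInt f s t).
{ apply (@ex_RInt_continuous R_CompleteNormedModule); intros x Hx.
  rewrite Rmin_left, Rmax_right in Hx by assumption; apply K; lra. }
assert (J : ex_RInt (fun _ => f s) s t) by apply ex_RInt_const.
replace (RInt f s t - (t - s) * f s) with (RInt (fun x => minus (f x) (f s)) s t).
- rewrite Rmult_comm; apply abs_RInt_le_const; [assumption | |].
  + now apply (@ex_RInt_minus R_NormedModule).
  + intros x Hx; left; apply (Hd s x); [lra | lra |].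
    change (Rabs (x - s) < delta); rewrite Rabs_pos_eq; lra.
- rewrite (@RInt_minus R_CompleteNormedModule) by assumption.
  rewrite RInt_const; reflexivity.
Qed.

(** * One-sided and two-sided derivatives *)

Lemma is_derive_within_iff (D : R -> Prop) (f : R -> E3) (x : R) (l : E3) :
  D x ->
  is_derive_within D f x l <->
  forall eps, 0 < eps -> exists delta, 0 < delta /\
    forall y, D y -> Rabs (y - x) < delta ->
      norm (minus (minus (f y) (f x)) (scal (y - x) l)) <= eps * Rabs (y - x).
Proof.
intros Dx; split.
- intros [_ H] eps He.
  destruct (H x (fun P HP => filter_imp _ _ (fun y Hy _ => Hy) HP) (mkposreal eps He)) as [d Hd].
  exists d; split; [apply cond_pos |].
  intros y Dy Hy; exact (Hd y Hy Dy).
- intros H; split.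
  { exact (@is_linear_scal_l R_AbsRing E3 l). }
  intros x' Hx' eps.
  assert (x = x') as <-.
  { apply (eq_close (K := R_AbsRing) (V := R_NormedModule)); intros e.
    assert (L : locally x' (fun y => ball x' e y)) by now exists e.
    specialize (Hx' _ L).
    apply ball_sym, (locally_singleton x (fun y => D y -> ball x' e y)); assumption. }
  destruct (H eps (cond_pos eps)) as (d & Pd & Hd).
  exists (mkposreal d Pd); intros y Hy Dy; now apply Hd.
Qed.

Lemma is_derive_iff (f : R -> E3) (x : R) (l : E3) :
  is_derive f x l <-> is_derive_within (fun _ => True) f x l.
Proof.
split; intros [L H]; split; try exact L; intros y Hy eps.
- assert (Hy' : is_filter_lim (locally x) y).
  { intros P HP.
    exact (filter_imp (F := locally x) _ _ (fun z Hz => Hz I) (Hy P HP)). }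
  apply (filter_imp _ _ (fun z Hz _ => Hz) (H y Hy' eps)).
- assert (Hy' : is_filter_lim (within (fun _ => True) (locally x)) y).
  { intros P HP; exact (filter_imp (F := locally x) _ _ (fun z Hz _ => Hz) (Hy P HP)). }
  specialize (H y Hy' eps); unfold within in H.
  eapply filter_imp; [| exact H]; intros z Hz; exact (Hz I).
Qed.

(** Passes between a curve on an interval and its extensions, which agree with
it only there. *)
Lemma is_derive_within_weaken (D D' : R -> Prop) (f f' : R -> E3) (x d : R) (l : E3) :
  0 < d -> D x -> D' x -> 
  (forall y, D' y -> Rabs (y - x) < d -> D y /\ f' y = f y) ->
  is_derive_within D f x l -> is_derive_within D' f' x l.
Proof.
intros Pd Dx Dx' E H.
apply is_derive_within_iff; [exact Dx' |].
intros eps He.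
destruct (proj1 (is_derive_within_iff D f x l Dx) H eps He) as (e & Pe & He').
exists (Rmin d e); split; [now apply Rmin_pos |].
intros y Dy Hy.
destruct (E y Dy) as [Ey ->]; [eapply Rlt_le_trans; [exact Hy | apply Rmin_l] |].
destruct (E x Dx') as [_ ->]; [rewrite Rminus_eq_0, Rabs_R0; exact Pd |].
apply He'; [exact Ey | eapply Rlt_le_trans; [exact Hy | apply Rmin_r]].
Qed.

Definition limit_point (D : R -> Prop) (x : R) : Prop :=
  forall delta, 0 < delta -> exists y, D y /\ y <> x /\ Rabs (y - x) < delta.

Lemma limit_point_right (D : R -> Prop) (x b : R) :
  x < b -> (forall y, x <= y <= b -> D y) -> limit_point D x.
Proof.
intros H HD d Hd; exists (Rmin b (x + d / 2)).
assert (x < Rmin b (x + d / 2)) by (apply Rmin_glb_lt; lra).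
pose proof (Rmin_l b (x + d / 2)); pose proof (Rmin_r b (x + d / 2)).
split; [apply HD; lra | split; [lra | rewrite Rabs_pos_eq; lra]].
Qed.

Lemma limit_point_left (D : R -> Prop) (a x : R) :
  a < x -> (forall y, a <= y <= x -> D y) -> limit_point D x.
Proof.
intros H HD d Hd; exists (Rmax a (x - d / 2)).
assert (Rmax a (x - d / 2) < x) by (apply Rmax_lub_lt; lra).
pose proof (Rmax_l a (x - d / 2)); pose proof (Rmax_r a (x - d / 2)).
split; [apply HD; lra | split; [lra | rewrite Rabs_left1; lra]].
Qed.

Lemma limit_point_cc (a b x : R) : a < b -> cc a b x -> limit_point (cc a b) x.
Proof.
intros H Hx; unfold cc in *; destruct (Rlt_le_dec x b).
- apply limit_point_right with b; [assumption | intros; lra].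
- apply limit_point_left with a; [| intros]; lra.
Qed.

Lemma is_derive_within_unique (D : R -> Prop) (f : R -> E3) (x : R) (l l' : E3) :
  D x -> limit_point D x ->
  is_derive_within D f x l -> is_derive_within D f x l' -> l = l'.
Proof.
intros Dx Acc H H'.
destruct (classic (l = l')) as [E | N]; [exact E | exfalso].
assert (P : 0 < norm (minus l l')) by now apply norm_minus_gt_0.
set (e := norm (minus l l') / 3).
destruct (proj1 (is_derive_within_iff D f x l Dx) H e) as (d & Pd & Hd); [unfold e; lra |].
destruct (proj1 (is_derive_within_iff D f x l' Dx) H' e) as (d' & Pd' & Hd'); [unfold e; lra |].
destruct (Acc (Rmin d d')) as (y & Dy & Ny & Hy); [now apply Rmin_pos |].
specialize (Hd y Dy (Rlt_le_trans _ _ _ Hy (Rmin_l _ _))).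
specialize (Hd' y Dy (Rlt_le_trans _ _ _ Hy (Rmin_r _ _))).
set (u := minus (f y) (f x)) in *.
assert (E : scal (y - x) (minus l l')
            = minus (minus u (scal (y - x) l')) (minus u (scal (y - x) l)))
  by (clearbody u; clear; vector_ring).
assert (Q : norm (scal (y - x) (minus l l')) <= 2 * e * Rabs (y - x)).
{ rewrite E; unfold minus at 1.
  eapply Rle_trans; [apply (@norm_triangle R_AbsRing E3) |].
  rewrite norm_opp; lra. }
rewrite norm_scal_E3 in Q.
assert (0 < Rabs (y - x)) by (apply Rabs_pos_lt; lra).
unfold e in Q; nra.
Qed.

Lemma derive_within_eq (D : R -> Prop) (f : R -> E3) (x : R) (l : E3) :
  D x -> limit_point D x ->
  is_derive_within D f x l -> derive_within D f x = l.
Proof.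
intros Dx Acc H; apply (is_derive_within_unique D f x); try assumption.
apply (epsilon_spec _ (is_derive_within D f x)); now exists l.
Qed.

Lemma derive_within_correct (D : R -> Prop) (f : R -> E3) (x : R) :
  ex_derive_within D f x -> is_derive_within D f x (derive_within D f x).
Proof. apply (epsilon_spec _ (is_derive_within D f x)). Qed.

Definition clamp (a b x : R) : R := Rmax a (Rmin b x).

Lemma clamp_in (a b x : R) : a <= b -> cc a b (clamp a b x).
Proof.
intros H; split; [apply Rmax_l |].
apply Rmax_lub; [exact H | apply Rmin_l].
Qed.

Lemma clamp_id (a b x : R) : cc a b x -> clamp a b x = x.
Proof. intros [H H']; unfold clamp; rewrite Rmin_right, Rmax_right; lra. Qed.

Lemma clamp_lipschitz (a b x y : R) :
  Rabs (clamp a b y - clamp a b x) <= Rabs (y - x).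
Proof. unfold clamp, Rmax, Rmin; repeat destruct Rle_dec; split_Rabs; lra. Qed.

(** Outside [a,b] the function follows its tangents at the end points, which
makes one-sided derivatives at [a] and [b] two-sided. *)
Definition linear_extension (a b : R) (f f' : R -> E3) (x : R) : E3 :=
  plus (f (clamp a b x)) (scal (x - clamp a b x) (f' (clamp a b x))).

Lemma linear_extension_id (a b : R) (f f' : R -> E3) (x : R) :
  cc a b x -> linear_extension a b f f' x = f x.
Proof.
intros H; unfold linear_extension; rewrite clamp_id by exact H.
replace (x - x) with (@zero R_Ring) by (unfold zero; simpl; ring).
rewrite (@scal_zero_l R_Ring E3); apply plus_zero_r.
Qed.

Lemma is_derive_linear_extension (a b : R) (f f' : R -> E3) (x : R) :
  a < b -> cc a b x -> is_derive_within (cc a b) f x (f' x) ->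
  is_derive (linear_extension a b f f') x (f' x).
Proof.
intros Hab Hx D; apply is_derive_iff, is_derive_within_iff; [exact I |].
intros eps He.
destruct (proj1 (is_derive_within_iff _ _ _ _ Hx) D eps He) as (d & Pd & Hd).
(* near [x], a point outside [a,b] is clamped to [x] itself *)
assert (N : exists e, 0 < e /\ forall y, Rabs (y - x) < e -> cc a b y \/ clamp a b y = x).
{ unfold cc in *; destruct (Rlt_le_dec a x), (Rlt_le_dec x b).
  - exists (Rmin (x - a) (b - x)); split; [apply Rmin_pos; lra |].
    intros y Hy; pose proof (Rmin_l (x - a) (b - x)); pose proof (Rmin_r (x - a) (b - x)).
    apply Rabs_lt_between in Hy; left; lra.
  - exists (b - a); split; [lra |].
    intros y Hy; apply Rabs_lt_between in Hy.
    destruct (Rle_lt_dec y b); [left; lra | right].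
    unfold clamp; rewrite Rmin_left, Rmax_right; lra.
  - exists (b - a); split; [lra |].
    intros y Hy; apply Rabs_lt_between in Hy.
    destruct (Rle_lt_dec a y); [left; lra | right].
    unfold clamp; rewrite Rmin_right, Rmax_left; lra.
  - lra. }
destruct N as (e & Pe & He').
exists (Rmin d e); split; [now apply Rmin_pos |].
intros y _ Hy; rewrite (linear_extension_id a b f f' x Hx).
destruct (He' y) as [Cy | Cy]; [eapply Rlt_le_trans; [exact Hy | apply Rmin_r] | |].
- rewrite linear_extension_id by exact Cy.
  apply Hd; [exact Cy | eapply Rlt_le_trans; [exact Hy | apply Rmin_l]].
- unfold linear_extension; rewrite Cy.
  set (u := f x); set (l := f' x).
  replace (minus _ _) with (@zero E3) by (clearbody u l; clear; vector_ring).
  rewrite norm_zero; apply Rmult_le_pos; [lra | apply Rabs_pos].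
Qed.

Lemma continuous_clamp (a b : R) (f : R -> E3) (x : R) :
  a <= b -> cc a b x -> continuous_on (cc a b) f ->
  continuous (fun y => f (clamp a b y)) x.
Proof.
intros Hab Hx K; unfold continuous; rewrite (clamp_id a b x Hx).
apply (filterlim_comp _ _ _ (clamp a b) f (locally x) (within (cc a b) (locally x)));
  [| exact (K x Hx)].
intros P [d Hd]; exists d; intros y Hy; apply Hd; [| now apply clamp_in].
change (Rabs (clamp a b y - x) < d).
rewrite <- (clamp_id a b x Hx) at 1.
eapply Rle_lt_trans; [apply clamp_lipschitz | exact Hy].
Qed.

(** The derivatives are ordinary two-sided ones, also at the end points, so that
a chart restricts to subintervals and the usual calculus applies to it; this is
why [G] is allowed to differ from [g] outside [a,b].  Second derivatives are
needed since the tangent must be differentiated. *)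
Definition arc_chart (a b : R) (g G H A : R -> E3) : Prop :=
  forall t, a <= t <= b ->
    G t = g t /\ is_derive G t (H t) /\ is_derive H t (A t) /\
    continuous A t /\ H t <> zero.

Definition regular_arc (a b : R) (g : R -> E3) : Prop :=
  exists G H A, arc_chart a b g G H A.

(** [g] and its derivative are extended independently: the derivative of the
first extension is the second one on [a,b], where alone this matters. *)
Lemma C2_on_regular_arc (a b : R) (g : R -> E3) :
  a < b -> C2_on (cc a b) g -> regular_on (cc a b) g -> regular_arc a b g.
Proof.
intros Hab (D1 & D2 & K) Reg.
set (g1 := derive_within (cc a b) g) in *.
set (g2 := derive_within (cc a b) g1) in *.
exists (linear_extension a b g g1), (linear_extension a b g1 g2), (fun t => g2 (clamp a b t)).
intros t Ht; assert (Ct : cc a b t) by exact Ht.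
rewrite !(linear_extension_id a b _ _ t Ct), (clamp_id a b t Ct).
split; [reflexivity | split; [| split; [| split]]].
- apply is_derive_linear_extension; [exact Hab | exact Ct |].
  now apply derive_within_correct, D1.
- apply is_derive_linear_extension; [exact Hab | exact Ct |].
  now apply derive_within_correct, D2.
- apply continuous_clamp; [lra | exact Ct | exact K].
- now apply Reg.
Qed.

Lemma arc_chart_sub (a b a' b' : R) (g G H A : R -> E3) :
  a <= a' -> b' <= b -> arc_chart a b g G H A -> arc_chart a' b' g G H A.
Proof. intros ? ? C t Ht; apply C; lra. Qed.

Lemma arc_chart_within (a b x d : R) (D : R -> Prop) (g G H A : R -> E3) :
  arc_chart a b g G H A -> a <= x <= b ->
  D x -> limit_point D x ->
  0 < d -> (forall y, D y -> Rabs (y - x) < d -> a <= y <= b) ->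
  derive_within D g x = H x.
Proof.
intros C Hx Dx Acc Pd Sub; apply derive_within_eq; [exact Dx | exact Acc |].
apply (is_derive_within_weaken (fun _ => True) D G g x d); try easy.
- intros y Dy Hy; split; [exact I |].
  now destruct (C y (Sub y Dy Hy)) as (-> & _).
- now apply is_derive_iff, C.
Qed.

Lemma arc_chart_cc (a b x : R) (g G H A : R -> E3) :
  arc_chart a b g G H A -> a < b -> a <= x <= b -> derive_within (cc a b) g x = H x.
Proof.
intros C Hab Hx; apply (arc_chart_within a b x 1 _ g G H A); try easy; [| lra].
now apply limit_point_cc.
Qed.

Lemma arc_chart_left (a b x : R) (g G H A : R -> E3) :
  arc_chart a b g G H A -> a < x <= b -> left_derivative g x = H x.
Proof.
intros C Hx; unfold left_derivative.
apply (arc_chart_within a b x (x - a) _ g G H A); try easy; try lra.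
- apply limit_point_left with a; [lra | intros; lra].
- intros y Hy L; apply Rabs_lt_between in L; lra.
Qed.

Lemma arc_chart_right (a b x : R) (g G H A : R -> E3) :
  arc_chart a b g G H A -> a <= x < b -> right_derivative g x = H x.
Proof.
intros C Hx; unfold right_derivative.
apply (arc_chart_within a b x (b - x) _ g G H A); try easy; try lra.
- apply limit_point_right with b; [lra | intros; lra].
- intros y Hy L; apply Rabs_lt_between in L; lra.
Qed.

(** * Turning of the tangent of a smooth arc *)

Lemma is_derive_dot_self (F : R -> E3) (t : R) (l : E3) :
  is_derive F t l -> is_derive (fun x => dot (F x) (F x)) t (2 * dot (F t) l).
Proof.
intros D.
assert (D1 := is_derive_dot ((1, 0), 0) F t l D).
assert (D2 := is_derive_dot ((0, 1), 0) F t l D).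
assert (D3 := is_derive_dot ((0, 0), 1) F t l D).
assert (S := is_derive_plus _ _ t _ _
  (is_derive_plus _ _ t _ _ (is_derive_mult _ _ t _ _ D1 D1 Rmult_comm)
     (is_derive_mult _ _ t _ _ D2 D2 Rmult_comm)) (is_derive_mult _ _ t _ _ D3 D3 Rmult_comm)).
eapply is_derive_ext; [| evar_last; [exact S |]].
- intros x; cbv beta; unfold plus, mult, dot; simpl; ring.
- unfold plus, mult, dot; simpl; ring.
Qed.

Lemma is_derive_inv_norm (F : R -> E3) (t : R) (l : E3) :
  is_derive F t l -> F t <> zero ->
  is_derive (fun x => / norm (F x)) t (- dot (F t) l / norm (F t) ^ 3).
Proof.
intros D N.
assert (Q : 0 < dot (F t) (F t)).
{ rewrite <- norm_mult_self; apply norm_gt_0 in N; nra. }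
assert (S : is_derive (fun q => / sqrt q) (dot (F t) (F t))
              (- / (2 * sqrt (dot (F t) (F t)) ^ 3))).
{ pose proof (sqrt_lt_R0 _ Q); auto_derive; [repeat split; lra | field; lra]. }
assert (S' := is_derive_comp _ _ t _ _ S (is_derive_dot_self F t l D)).
eapply is_derive_ext; [| evar_last; [exact S' |]].
- intros x; cbv beta; now rewrite norm_E3.
- rewrite norm_E3; pose proof (sqrt_lt_R0 _ Q).
  unfold scal; simpl; unfold mult; simpl; field; lra.
Qed.

(** Derivative of [H / |H|] when [H' = A]. *)
Definition tangent_derivative (H A : R -> E3) (t : R) : E3 :=
  plus (scal (- dot (H t) (A t) / norm (H t) ^ 3) (H t)) (scal (/ norm (H t)) (A t)).

Lemma is_derive_unit_vector (H A : R -> E3) (t : R) :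
  is_derive H t (A t) -> H t <> zero ->
  is_derive (fun x => unit_vector (H x)) t (tangent_derivative H A t).
Proof.
intros D N.
assert (S := filterdiff_scal_fct (K := R_AbsRing) (U := AbsRing_NormedModule R_AbsRing) (V := E3)
  t _ _ _ _ Rmult_comm (is_derive_inv_norm H t (A t) D N) D).
eapply filterdiff_ext_lin; [exact S | intros y; cbv beta].
unfold tangent_derivative; rewrite (@scal_distr_l R_Ring E3).
f_equal; rewrite !(@scal_assoc R_Ring E3); [reflexivity |].
f_equal; apply Rmult_comm.
Qed.

Lemma continuous_dot (F G : R -> E3) (t : R) :
  continuous F t -> continuous G t -> continuous (fun x => dot (F x) (G x)) t.
Proof.
intros KF KG.
assert (C1 : forall F : R -> E3, continuous F t -> continuous (fun x => fst (fst (F x))) t).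
{ intros f K; apply (continuous_comp (fun x => fst (f x)) fst); [| apply continuous_fst].
  apply (continuous_comp f fst); [exact K | apply continuous_fst]. }
assert (C2 : forall F : R -> E3, continuous F t -> continuous (fun x => snd (fst (F x))) t).
{ intros f K; apply (continuous_comp (fun x => fst (f x)) snd); [| apply continuous_snd].
  apply (continuous_comp f fst); [exact K | apply continuous_fst]. }
assert (C3 : forall F : R -> E3, continuous F t -> continuous (fun x => snd (F x)) t).
{ intros f K; apply (continuous_comp f snd); [exact K | apply continuous_snd]. }
unfold dot.
apply (continuous_plus (V := R_NormedModule)); [apply (continuous_plus (V := R_NormedModule)) |];
  apply (continuous_mult (K := R_AbsRing)); auto.
Qed.

Lemma continuous_norm (F : R -> E3) (t : R) :
  continuous F t -> continuous (fun x => norm (F x)) t.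
Proof. intros K; apply (continuous_comp F norm); [exact K | apply filterlim_norm]. Qed.

Lemma continuous_tangent_derivative (H A : R -> E3) (t : R) :
  continuous H t -> continuous A t -> H t <> zero ->
  continuous (tangent_derivative H A) t.
Proof.
intros KH KA N; apply norm_gt_0 in N.
assert (KN : continuous (fun x => norm (H x)) t) by now apply continuous_norm.
assert (KI : continuous (fun x => / norm (H x)) t).
{ apply (continuous_Rinv_comp (fun x => norm (H x))); [exact KN | lra]. }
apply (continuous_plus (V := E3)); apply (continuous_scal (V := E3)); try assumption.
apply (continuous_mult (K := R_AbsRing)).
- apply (continuous_opp (V := R_NormedModule)); now apply continuous_dot.
- apply (continuous_Rinv_comp (fun x => norm (H x) ^ 3)); [| apply pow_nonzero; lra].
  apply (continuous_comp (fun x => norm (H x)) (fun y => y ^ 3)); [exact KN |].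
  apply (@ex_derive_continuous R_AbsRing R_NormedModule); auto_derive; exact I.
Qed.

(** Speed of the unit tangent on the sphere, that is curvature times speed. *)
Definition turning_rate (H A : R -> E3) (t : R) : R := norm (tangent_derivative H A t).

Section Arc.

Variables (a b : R) (g G H A : R -> E3).
Hypothesis Hchart : arc_chart a b g G H A.
Hypothesis Hab : a < b.

Lemma arc_is_derive_tangent (t : R) : a <= t <= b ->
  is_derive (fun x => unit_vector (H x)) t (tangent_derivative H A t).
Proof.
intros Ht; destruct (Hchart t Ht) as (_ & _ & D & _ & N).
now apply is_derive_unit_vector.
Qed.

Lemma arc_continuous_tangent_derivative (t : R) : a <= t <= b ->
  continuous (tangent_derivative H A) t.
Proof.
intros Ht; destruct (Hchart t Ht) as (_ & _ & D & K & N).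
apply continuous_tangent_derivative; try assumption.
apply (@ex_derive_continuous R_AbsRing E3); now exists (A t).
Qed.

Lemma arc_continuous_turning_rate (t : R) : a <= t <= b ->
  continuous (turning_rate H A) t.
Proof. intros Ht; now apply continuous_norm, arc_continuous_tangent_derivative. Qed.

Lemma arc_ex_RInt (s t : R) : a <= s -> s <= t -> t <= b ->
  ex_RInt (turning_rate H A) s t.
Proof.
intros ? ? ?; apply (@ex_RInt_continuous R_CompleteNormedModule); intros x Hx.
rewrite Rmin_left, Rmax_right in Hx by assumption.
apply arc_continuous_turning_rate; lra.
Qed.

Lemma arc_RInt_Chasles (s t u : R) : a <= s -> s <= t -> t <= u -> u <= b ->
  RInt (turning_rate H A) s t + RInt (turning_rate H A) t u = RInt (turning_rate H A) s u.
Proof.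
intros; apply (@RInt_Chasles R_CompleteNormedModule); apply arc_ex_RInt; lra.
Qed.

Lemma piece_curvature_turning : piece_curvature g a b = RInt (turning_rate H A) a b.
Proof.
unfold piece_curvature; apply (@RInt_ext R_CompleteNormedModule); intros t Ht.
rewrite Rmin_left, Rmax_right in Ht by lra.
assert (Ct : cc a b t) by (split; lra).
assert (U : forall y, cc a b y -> unit_tangent (cc a b) g y = unit_vector (H y)).
{ intros y Cy; unfold unit_tangent, speed.
  now rewrite (arc_chart_cc a b y g G H A Hchart Hab Cy). }
unfold curvature, speed.
rewrite (arc_chart_cc a b t g G H A Hchart Hab Ct).
replace (derive_within _ _ t) with (tangent_derivative H A t).
- assert (N : H t <> zero) by now apply Hchart.
  apply norm_gt_0 in N; fold (turning_rate H A t).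
  assert (0 <= turning_rate H A t) by apply norm_ge_0.
  rewrite Rabs_div, !Rabs_pos_eq by lra.
  match goal with |- @eq _ ?x ?y => change (@eq R x y) end; field; lra.
- symmetry; apply derive_within_eq; [exact Ct | now apply limit_point_cc |].
  apply (is_derive_within_weaken (fun _ => True) _ (fun x => unit_vector (H x)) _ t 1);
    [lra | exact I | exact Ct | | now apply is_derive_iff, arc_is_derive_tangent].
  intros y Cy _; split; [exact I | now apply U].
Qed.

(** Angle, chord of the unit tangent and integral all equal
[(t - s) * turning_rate H A s] up to an error small compared with [t - s],
uniformly on [a,b].  The upper bound on the angle gives the curvature of a smooth
arc as an upper bound of its tangent angles, the lower one gives the
approximation of the limit curve. *)
Lemma angle_turning_approx (eps : R) : 0 < eps ->
  exists delta, 0 < delta /\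
    forall s t, a <= s -> s <= t -> t <= b -> t - s < delta ->
      Rabs (angle (H s) (H t) - RInt (turning_rate H A) s t) <= eps * (t - s).
Proof.
intros He; (* one [e] for the derivative, one for the integral, one for chord against
   angle *)
set (e := Rmin 1 (eps / 4)).
assert (Pe : 0 < e /\ e <= 1 /\ 4 * e <= eps).
{ assert (0 < e) by (apply Rmin_pos; lra).
  assert (e <= 1) by apply Rmin_l; assert (e <= eps / 4) by apply Rmin_r; lra. }
destruct (increment_approx _ _ a b e arc_is_derive_tangent arc_continuous_tangent_derivative)
  as (d1 & P1 & H1); [lra |].
destruct (RInt_approx _ a b e arc_continuous_turning_rate) as (d2 & P2 & H2); [lra |].
destruct (continuity_ab_maj (turning_rate H A) a b) as (m & Hm & _); [lra | |].
{ intros c Hc; now apply continuity_pt_filterlim, arc_continuous_turning_rate. }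
set (M := turning_rate H A m + 1) in *.
assert (PM : 1 <= M).
{ unfold M, turning_rate; pose proof (norm_ge_0 (tangent_derivative H A m)); lra. }
(* chords are at most [M * (t - s)]; below [d3] their squares are negligible *)
set (d3 := e / (M * M)).
assert (P3 : 0 < d3) by (apply Rdiv_lt_0_compat; nra).
exists (Rmin d1 (Rmin d2 d3)); split; [repeat apply Rmin_pos; assumption |].
intros s t Has Hst Htb L.
assert (L1 : t - s < d1) by (eapply Rlt_le_trans; [exact L | apply Rmin_l]).
assert (L2 : t - s < d2).
{ eapply Rlt_le_trans; [exact L |]; eapply Rle_trans; [apply Rmin_r | apply Rmin_l]. }
assert (L3 : t - s < d3).
{ eapply Rlt_le_trans; [exact L |]; eapply Rle_trans; [apply Rmin_r | apply Rmin_r]. }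
specialize (H1 s t Has Hst Htb L1); specialize (H2 s t Has Hst Htb L2).
assert (Ns : H s <> zero) by (apply Hchart; lra).
assert (Nt : H t <> zero) by (apply Hchart; lra).
pose proof (@norm_triangle_inv R_AbsRing E3 (minus (unit_vector (H t)) (unit_vector (H s)))
  (scal (t - s) (tangent_derivative H A s))) as T.
fold (chord (H s) (H t)) in T.
rewrite norm_scal_E3, (Rabs_pos_eq (t - s)) in T by lra.
change (norm (tangent_derivative H A s)) with (turning_rate H A s) in T.
set (c := chord (H s) (H t)) in *.
assert (Hs : turning_rate H A s <= M - 1) by (unfold M; pose proof (Hm s); lra).
assert (Hs0 : 0 <= turning_rate H A s) by apply norm_ge_0.
assert (T' : Rabs (c - (t - s) * turning_rate H A s) <= e * (t - s)) by lra.
clear T H1; apply Rabs_le_between in T', H2.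
assert (C0 : 0 <= c) by apply norm_ge_0.
assert (C1 : c <= M * (t - s)) by nra.
assert (L4 : M * M * (t - s) <= e).
{ apply Rlt_le in L3; unfold d3 in L3.
  apply (Rmult_le_compat_l (M * M)) in L3; [| nra].
  replace (M * M * (e / (M * M))) with e in L3 by (field; lra); exact L3. }
assert (C2 : c <= 1) by nra.
assert (C3 : c * c <= e * (t - s)) by nra.
pose proof (chord_le_angle (H s) (H t) Ns Nt) as Lo.
pose proof (angle_le_chord (H s) (H t) Ns Nt C2) as Up.
fold c in Lo, Up.
apply Rabs_le_between; nra.
Qed.

End Arc.

(** * Directions of the chords of a smooth arc *)

(** Induction on an interval: a property stable under concatenation holds on
[a,b] once it holds on all short subintervals.  Applied to estimates with error
[eps * (t - s)], it adds them up. *)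
Lemma interval_subdivision (Q : R -> R -> Prop) (a b d : R) :
  a < b -> 0 < d ->
  (forall s t, a <= s -> s < t -> t <= b -> t - s < d -> Q s t) ->
  (forall s t u, a <= s -> s < t -> t < u -> u <= b -> Q s t -> Q t u -> Q s u) ->
  Q a b.
Proof.
intros Hab Hd Small Glue.
destruct (nfloor_ex ((b - a) / d)) as [n [_ Hn]].
{ apply Rlt_le, Rdiv_lt_0_compat; lra. }
rewrite <- S_INR in Hn.
set (h := (b - a) / INR (S n)).
assert (Pn : 0 < INR (S n)) by (apply lt_0_INR; lia).
assert (Ph : 0 < h) by (apply Rdiv_lt_0_compat; lra).
assert (Eh : INR (S n) * h = b - a) by (unfold h; field; lra).
assert (Hh : h < d).
{ apply Rlt_div_l in Hn; [| lra]; unfold h; apply Rlt_div_l; [lra |]; lra. }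
assert (Ind : forall k, (k <= n)%nat -> Q a (a + INR (S k) * h)).
{ induction k as [| k IH]; intros Hk.
  - simpl; apply Small; try lra.
    assert (1 <= INR (S n)) by (rewrite S_INR; pose proof (pos_INR n); lra); nra.
  - assert (Le : INR (S (S k)) <= INR (S n)) by (apply le_INR; lia).
    assert (Pk : 0 <= INR k) by apply pos_INR.
    rewrite !S_INR in *.
    apply Glue with (a + (INR k + 1) * h); try nra.
    + apply IH; lia.
    + apply Small; nra. }
specialize (Ind n (Nat.le_refl n)); rewrite Eh in Ind.
now replace (a + (b - a)) with b in Ind by ring.
Qed.

(** A path on the sphere is at least as long as the great arc between its ends. *)
Lemma angle_le_turning (a b : R) (g G H A : R -> E3) :
  arc_chart a b g G H A -> a < b ->
  angle (H a) (H b) <= RInt (turning_rate H A) a b.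
Proof.
intros C Hab.
apply le_epsilon; intros eps He.
set (e := eps / (b - a)).
assert (Pe : 0 < e) by (apply Rdiv_lt_0_compat; lra).
destruct (angle_turning_approx a b g G H A C Hab e Pe) as (d & Pd & Hd).
replace eps with (e * (b - a)) by (unfold e; field; lra).
apply (interval_subdivision
  (fun s t => angle (H s) (H t) <= RInt (turning_rate H A) s t + e * (t - s)) a b d Hab Pd).
- intros s t ? ? ? L; specialize (Hd s t); apply Rabs_le_between in Hd; lra.
- intros s t u ? ? ? ? H1 H2.
  pose proof (angle_triangle (H s) (H t) (H u)).
  rewrite <- (arc_RInt_Chasles a b g G H A C s t u) by lra; lra.
Qed.

(** Concatenation of two arcs at a corner.  Here [u], [w] are the tangents at the
ends of the first arc and [v] its displacement, [u'], [w'], [v'] those of the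
second.  The detour through [v + v'] is no longer than the one through [v] and
[v'], by [angle_plus]; a vanishing displacement is where the tangent bounds
[angle u w <= K] and [angle u' w' <= K'] are used. *)
Lemma angle_chord_concat (u w u' w' v v' : E3) (K K' : R) :
  angle u w <= K -> angle u' w' <= K' ->
  (v <> zero -> angle u v + angle v w <= K) ->
  (v' <> zero -> angle u' v' + angle v' w' <= K') ->
  plus v v' <> zero ->
  angle u (plus v v') + angle (plus v v') w' <= K + angle w u' + K'.
Proof.
intros HK HK' Hv Hv' N.
pose proof (angle_triangle w u' w').
pose proof (angle_triangle u w u').
destruct (classic (v = zero)) as [-> | Nv];
  [| destruct (classic (v' = zero)) as [-> | Nv']].
- rewrite plus_zero_l in *; specialize (Hv' N).
  pose proof (angle_triangle u u' v'); lra.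
- rewrite plus_zero_r in *; specialize (Hv N).
  pose proof (angle_triangle v w w'); lra.
- specialize (Hv Nv); specialize (Hv' Nv').
  pose proof (angle_plus v v' Nv Nv' N).
  pose proof (angle_triangle u v (plus v v')).
  pose proof (angle_triangle (plus v v') v' w').
  pose proof (angle_triangle v w v').
  pose proof (angle_triangle w u' v').
  lra.
Qed.

(** The detour through the direction of the chord is no longer than the path of
the tangent.  For a Riemann sum of the velocity in place of the chord this
follows step by step from [angle_chord_concat] with trivial corners; the angle is
continuous at the nonzero chord, so the inequality survives the limit. *)
Lemma smooth_arc_chord (a b : R) (g G H A : R -> E3) :
  arc_chart a b g G H A -> a < b -> minus (g b) (g a) <> zero ->
  angle (H a) (minus (g b) (g a)) + angle (minus (g b) (g a)) (H b)
  <= RInt (turning_rate H A) a b.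
Proof.
intros C Hab N.
replace (g b) with (G b) in * by (apply C; lra).
replace (g a) with (G a) in * by (apply C; lra).
set (v := minus (G b) (G a)) in *.
apply le_epsilon; intros eta He.
destruct (angle_near v (eta / 2) N) as (d & Pd & Hd); [lra |].
set (e := d / (2 * (b - a))).
assert (Pe : 0 < e) by (apply Rdiv_lt_0_compat; lra).
destruct (increment_approx G H a b e) as (d' & Pd' & Hd'); [| | exact Pe |].
{ intros x Hx; now apply C. }
{ intros x Hx; apply (@ex_derive_continuous R_AbsRing E3); exists (A x); now apply C. }
(* [w] is a Riemann sum of the velocity; it may vanish, even though [v] does not *)
destruct (interval_subdivision (fun s t => exists w : E3,
    norm (minus w (minus (G t) (G s))) <= e * (t - s) /\
    (w <> zero -> angle (H s) w + angle w (H t) <= RInt (turning_rate H A) s t))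
  a b d' Hab Pd') as (w & Hw & Kw).
- intros s t ? ? ? L; exists (scal (t - s) (H s)); split.
  + rewrite <- norm_opp, opp_minus; apply Hd'; lra.
  + intros _; rewrite angle_scal_r, angle_scal_l by lra.
    rewrite angle_same by (apply C; lra).
    rewrite Rplus_0_l; apply (angle_le_turning s t g G H A); [| assumption].
    now apply arc_chart_sub with a b.
- intros s t u ? ? ? ? (w & Hw & Kw) (w' & Hw' & Kw').
  exists (plus w w'); split.
  + set (p := G s) in *; set (q := G t) in *; set (r := G u) in *.
    replace (minus (plus w w') (minus r p))
      with (plus (minus w (minus q p)) (minus w' (minus r q)))
      by (clearbody p q r; clear; vector_ring).
    eapply Rle_trans; [apply (@norm_triangle R_AbsRing E3) | lra].
  + intros Nw.
    rewrite <- (arc_RInt_Chasles a b g G H A C s t u) by lra.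
    assert (N0 : H t <> zero) by (apply C; lra).
    (* at [t] there is a corner of angle 0 *)
    rewrite <- (Rplus_0_r (RInt _ s t)), <- (angle_same (H t) N0).
    apply angle_chord_concat; try assumption;
      apply angle_le_turning with g G; try assumption;
      apply arc_chart_sub with a b; try assumption; lra.
- assert (B : norm (minus w v) < d).
  { eapply Rle_lt_trans; [exact Hw |].
    unfold e; replace (d / (2 * (b - a)) * (b - a)) with (d / 2) by (field; lra); lra. }
  destruct (Hd w B) as [Nw Aw]; specialize (Kw Nw).
  pose proof (angle_triangle (H a) w v); pose proof (angle_triangle v w (H b)).
  rewrite (angle_sym w v) in *; lra.
Qed.

(** * Total curvature of piecewise smooth arcs *)

(** [arc_curvature g a b K]: the restriction of [g] to [a,b] is piecewise regular
C2 with total curvature [K], end points contributing no angle.  Being generated by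
concatenation, it forgets the partition, so that arcs can be cut and compared
freely. *)
Inductive arc_curvature (g : R -> E3) : R -> R -> R -> Prop :=
| smooth_arc_curvature (a b : R) :
    a < b -> regular_arc a b g -> arc_curvature g a b (piece_curvature g a b)
| glued_arc_curvature (a b c K K' : R) :
    arc_curvature g a b K -> arc_curvature g b c K' ->
    arc_curvature g a c (K + exterior_angle g b + K').

Lemma arc_curvature_lt (g : R -> E3) (a b K : R) : arc_curvature g a b K -> a < b.
Proof. induction 1; lra. Qed.

Lemma exterior_angle_smooth (a b t : R) (g : R -> E3) :
  regular_arc a b g -> a < t < b -> exterior_angle g t = 0.
Proof.
intros (G & H & A & C) Ht; unfold exterior_angle.
rewrite (arc_chart_left a b t g G H A C), (arc_chart_right a b t g G H A C) by lra.
apply angle_same, C; lra.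
Qed.

Lemma regular_arc_sub (a b a' b' : R) (g : R -> E3) :
  a <= a' -> b' <= b -> regular_arc a b g -> regular_arc a' b' g.
Proof.
intros ? ? (G & H & A & C); exists G, H, A; now apply arc_chart_sub with a b.
Qed.

Lemma piece_curvature_split (a b c : R) (g : R -> E3) :
  regular_arc a c g -> a < b -> b < c ->
  piece_curvature g a c = piece_curvature g a b + exterior_angle g b + piece_curvature g b c.
Proof.
intros Reg Hab Hbc; rewrite (exterior_angle_smooth a c b g Reg) by lra.
destruct Reg as (G & H & A & C).
rewrite (piece_curvature_turning a c g G H A), (piece_curvature_turning a b g G H A),
  (piece_curvature_turning b c g G H A); try lra; try assumption;
  try (apply arc_chart_sub with a c; try assumption; lra).
rewrite <- (arc_RInt_Chasles a c g G H A C a b c) by lra; ring.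
Qed.

(** Superfluous breakpoints contribute exterior angle 0 and the integrals add
up, so the value on a smooth arc does not depend on the decomposition. *)
Lemma arc_curvature_smooth (g : R -> E3) (a b K : R) :
  arc_curvature g a b K -> regular_arc a b g -> K = piece_curvature g a b.
Proof.
induction 1 as [a b Hab _ | a b c K K' H1 IH1 H2 IH2]; intros Reg; [reflexivity |].
apply arc_curvature_lt in H1, H2.
rewrite (piece_curvature_split a b c g Reg H1 H2), IH1, IH2; [reflexivity | |];
  apply regular_arc_sub with a c; try assumption; lra.
Qed.

(** A cut inside a smooth piece is a breakpoint with exterior angle 0. *)
Lemma arc_curvature_split (g : R -> E3) (a b c K : R) :
  arc_curvature g a c K -> a < b -> b < c ->
  exists K1 K2, arc_curvature g a b K1 /\ arc_curvature g b c K2 /\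
    K = K1 + exterior_angle g b + K2.
Proof.
intros H; revert b.
induction H as [a c Hac Reg | a m c K K' H1 IH1 H2 IH2]; intros b Hab Hbc.
- exists (piece_curvature g a b), (piece_curvature g b c).
  repeat split; [| | now apply piece_curvature_split];
    apply smooth_arc_curvature; try assumption; apply regular_arc_sub with a c; try assumption; lra.
- destruct (Rtotal_order b m) as [L | [-> | L]].
  + destruct (IH1 b Hab L) as (K1 & K2 & A1 & A2 & ->).
    exists K1, (K2 + exterior_angle g m + K'); repeat split;
      [exact A1 | now apply glued_arc_curvature | ring].
  + now exists K, K'.
  + destruct (IH2 b L Hbc) as (K1 & K2 & A1 & A2 & ->).
    exists (K + exterior_angle g m + K1), K2; repeat split;
      [now apply glued_arc_curvature | exact A2 | ring].
Qed.

Lemma arc_curvature_tangents (g : R -> E3) (a b K : R) :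
  arc_curvature g a b K -> angle (right_derivative g a) (left_derivative g b) <= K.
Proof.
induction 1 as [a b Hab (G & H & A & C) | a b c K K' H1 IH1 H2 IH2].
- rewrite (arc_chart_right a b a g G H A C), (arc_chart_left a b b g G H A C) by lra.
  rewrite (piece_curvature_turning a b g G H A C Hab).
  now apply angle_le_turning with g G.
- pose proof (angle_triangle (right_derivative g a) (left_derivative g b) (left_derivative g c)).
  pose proof (angle_triangle (left_derivative g b) (right_derivative g b) (left_derivative g c)).
  unfold exterior_angle; lra.
Qed.

Lemma arc_curvature_chord (g : R -> E3) (a b K : R) :
  arc_curvature g a b K -> minus (g b) (g a) <> zero ->
  angle (right_derivative g a) (minus (g b) (g a))
  + angle (minus (g b) (g a)) (left_derivative g b) <= K.
Proof.
induction 1 as [a b Hab (G & H & A & C) | a b c K K' H1 IH1 H2 IH2]; intros N.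
- rewrite (arc_chart_right a b a g G H A C), (arc_chart_left a b b g G H A C) by lra.
  rewrite (piece_curvature_turning a b g G H A C Hab).
  now apply smooth_arc_chord with G.
- set (p := g a) in *; set (q := g b) in *; set (r := g c) in *.
  assert (E : minus r p = plus (minus q p) (minus r q))
    by (clearbody p q r; clear; vector_ring).
  rewrite E in *; apply angle_chord_concat; try assumption; now apply arc_curvature_tangents.
Qed.

(** Milnor's bound of curvature by secants.  The gap between [p] and [q] may
return to the same point: it is crossed along tangents, not along its chord, so
only the two outer secants have to be nonzero. *)
Lemma angle_two_chords (g : R -> E3) (a p q b K : R) :
  arc_curvature g a b K -> a < p -> p < q -> q < b ->
  minus (g p) (g a) <> zero -> minus (g b) (g q) <> zero ->
  angle (minus (g p) (g a)) (minus (g b) (g q)) <= K.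
Proof.
intros H Hap Hpq Hqb N1 N2.
destruct (arc_curvature_split g a p b K H) as (K1 & K' & H1 & H' & ->); [lra | lra |].
destruct (arc_curvature_split g p q b K' H') as (K2 & K3 & H2 & H3 & ->); [lra | lra |].
pose proof (arc_curvature_chord g a p K1 H1 N1) as C1.
pose proof (arc_curvature_chord g q b K3 H3 N2) as C3.
pose proof (arc_curvature_tangents g p q K2 H2) as C2.
set (v := minus (g p) (g a)) in *; set (w := minus (g b) (g q)) in *.
pose proof (angle_triangle v (left_derivative g p) w).
pose proof (angle_triangle (left_derivative g p) (right_derivative g p) w).
pose proof (angle_triangle (right_derivative g p) (left_derivative g q) w).
pose proof (angle_triangle (left_derivative g q) (right_derivative g q) w).
pose proof (angle_bound (right_derivative g a) v).
pose proof (angle_bound w (left_derivative g b)).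
unfold exterior_angle; lra.
Qed.

Lemma regular_arc_C2_on (a b : R) (g : R -> E3) :
  a < b -> regular_arc a b g -> C2_on (cc a b) g /\ regular_on (cc a b) g.
Proof.
intros Hab (G & H & A & C).
assert (E1 : forall t, cc a b t -> derive_within (cc a b) g t = H t)
  by (intros t Ht; now apply (arc_chart_cc a b t g G H A)).
assert (D1 : forall t, cc a b t -> is_derive_within (cc a b) g t (H t)).
{ intros t Ht; apply (is_derive_within_weaken (fun _ => True) _ G _ t 1);
    [lra | exact I | exact Ht | | now apply is_derive_iff, C].
  intros y Hy _; split; [exact I | symmetry; now apply C]. }
assert (D2 : forall t, cc a b t ->
  is_derive_within (cc a b) (derive_within (cc a b) g) t (A t)).
{ intros t Ht; apply (is_derive_within_weaken (fun _ => True) _ H _ t 1);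
    [lra | exact I | exact Ht | | now apply is_derive_iff, C].
  intros y Hy _; split; [exact I | now apply E1]. }
assert (E2 : forall t, cc a b t ->
  derive_within (cc a b) (derive_within (cc a b) g) t = A t).
{ intros t Ht; apply derive_within_eq; [exact Ht | now apply limit_point_cc | now apply D2]. }
split; [split; [| split] |].
- intros t Ht; exists (H t); now apply D1.
- intros t Ht; exists (A t); now apply D2.
- intros t Ht; rewrite (E2 t Ht); intros P HP.
  assert (K : continuous A t) by now apply C.
  apply (filter_imp (F := locally t) (fun y => P (A y))); [| exact (K P HP)].
  intros y Hy Cy; rewrite (E2 y Cy); exact Hy.
- intros t Ht; rewrite (E1 t Ht); now apply C.
Qed.

Lemma partition_arc_curvature (n : nat) (t : nat -> R) (g : R -> E3) :
  piecewise_C2_for n t g ->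
  exists K, arc_curvature g 0 1 K /\ total_curvature_for n t g = K + closing_angle g.
Proof.
intros [(T0 & T1 & Inc) P].
destruct n as [| n]; [lra |].
exists (sum_n_m (fun k => piece_curvature g (t k) (t (S k))) 0 n
  + sum_n_m (fun k => exterior_angle g (t k)) 1 n).
split; [| reflexivity].
rewrite <- T0 at 1; rewrite <- T1.
assert (Piece : forall k, (k < S n)%nat ->
  arc_curvature g (t k) (t (S k)) (piece_curvature g (t k) (t (S k)))).
{ intros k Hk; apply smooth_arc_curvature; [now apply Inc |].
  apply C2_on_regular_arc; [now apply Inc | now apply P ..]. }
assert (Ind : forall k, (k < S n)%nat -> arc_curvature g (t 0%nat) (t (S k))
  (sum_n_m (fun k => piece_curvature g (t k) (t (S k))) 0 k
   + sum_n_m (fun k => exterior_angle g (t k)) 1 k)); [| apply Ind; lia].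
induction k as [| k IH]; intros Hk.
- rewrite sum_n_n, sum_n_m_zero by lia.
  change (@zero R_AbelianMonoid) with 0; rewrite Rplus_0_r; now apply Piece.
- rewrite !sum_n_Sm by lia.
  match goal with |- arc_curvature _ _ _ ?e =>
    replace e with (sum_n_m (fun k => piece_curvature g (t k) (t (S k))) 0 k
      + sum_n_m (fun k => exterior_angle g (t k)) 1 k
      + exterior_angle g (t (S k)) + piece_curvature g (t (S k)) (t (S (S k))))
      by (unfold plus; simpl; ring) end.
  apply glued_arc_curvature; [apply IH; lia | now apply Piece].
Qed.

(** The partition selected by the choice operator is unknown, but
[arc_curvature] holds for whichever one it is. *)
Lemma total_curvature_arc (g : R -> E3) : piecewise_C2 g ->
  exists K, arc_curvature g 0 1 K /\ total_curvature g = K + closing_angle g.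
Proof.
intros (n & t & P).
assert (E : exists T, is_total_curvature g T)
  by now exists (total_curvature_for n t g), n, t.
destruct (epsilon_spec (inhabits 0) _ E) as (m & s & P' & Em).
fold (total_curvature g) in Em; rewrite Em.
now apply partition_arc_curvature.
Qed.

Lemma closing_angle_ge_0 (g : R -> E3) : 0 <= closing_angle g.
Proof.
unfold closing_angle; destruct excluded_middle_informative; [apply angle_bound | lra].
Qed.

(** * Closed curves through their periodic extension *)

Lemma frac_part_small (t : R) : 0 <= t < 1 -> frac_part t = t.
Proof.
intros Ht; unfold frac_part.
rewrite <- (Int_part_spec t 0); simpl; lra.
Qed.

Lemma frac_part_succ (t : R) : frac_part (t + 1) = frac_part t.
Proof.
unfold frac_part.
rewrite <- (Int_part_spec (t + 1) (Int_part t + 1)).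
- rewrite plus_IZR; ring.
- rewrite plus_IZR; pose proof (base_Int_part t); lra.
Qed.

Lemma periodic_extension_id (g : R -> E3) (t : R) :
  closed_curve g -> 0 <= t <= 1 -> periodic_extension g t = g t.
Proof.
intros Cl Ht; unfold periodic_extension.
destruct (Rlt_le_dec t 1); [now rewrite frac_part_small by lra |].
replace t with (0 + 1) by lra.
rewrite frac_part_succ, frac_part_small, Rplus_0_l by lra; exact Cl.
Qed.

(** The periodic extension is itself a two-sided differentiable extension of the
curve, and its velocity is periodic, whence the equal end velocities. *)
Lemma closed_curve_chart (g : R -> E3) :
  closed_curve g -> C2_on (fun _ => True) (periodic_extension g) ->
  regular_on (fun _ => True) (periodic_extension g) ->
  exists G H A, arc_chart 0 1 g G H A /\ H 1 = H 0.
Proof.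
intros Cl (D1 & D2 & K) Reg.
set (P := periodic_extension g) in *.
set (P1 := derive_within (fun _ => True) P) in *.
set (P2 := derive_within (fun _ => True) P1) in *.
exists P, P1, P2; split.
- intros t Ht; split; [now apply periodic_extension_id | split; [| split; [| split]]].
  + now apply is_derive_iff, derive_within_correct, D1.
  + now apply is_derive_iff, derive_within_correct, D2.
  + intros Q HQ; exact (filter_imp (F := locally t) _ _ (fun y Hy => Hy I) (K t I Q HQ)).
  + now apply Reg.
- symmetry; apply derive_within_eq; [exact I | |].
  { apply limit_point_right with 1; [lra | easy]. }
  assert (D := derive_within_correct _ _ _ (D1 1 I)); fold P1 in D.
  apply is_derive_within_iff; [exact I |]; intros eps He.
  destruct (proj1 (is_derive_within_iff _ _ 1 _ I) D eps He) as (d & Pd & Hd).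
  exists d; split; [exact Pd |]; intros y _ Hy.
  assert (Per : forall x, P (x + 1) = P x)
    by (intros x; unfold P, periodic_extension; now rewrite frac_part_succ).
  specialize (Hd (y + 1) I).
  replace (y + 1 - 1) with (y - 0) in Hd by ring.
  replace (P 1) with (P 0) in Hd by (rewrite <- (Per 0); f_equal; ring).
  rewrite Per in Hd; now apply Hd.
Qed.

Lemma regular_curve_chart (g : R -> E3) :
  regular_curve g -> C2_curve g -> regular_arc 0 1 g /\ closing_angle g = 0.
Proof.
intros [R1 R2] [D1 D2]; unfold closing_angle.
destruct excluded_middle_informative as [Cl | Op].
- destruct (closed_curve_chart g Cl (D1 Cl) (R1 Cl)) as (G & H & A & C & E).
  split; [now exists G, H, A |].
  rewrite (arc_chart_left 0 1 1 g G H A C), (arc_chart_right 0 1 0 g G H A C) by lra.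
  rewrite E; apply angle_same, C; lra.
- split; [apply C2_on_regular_arc; [lra | auto ..] | reflexivity].
Qed.

Lemma total_curvature_regular (g : R -> E3) :
  regular_arc 0 1 g -> closing_angle g = 0 -> total_curvature g = piece_curvature g 0 1.
Proof.
intros Reg Cl.
destruct (total_curvature_arc g) as (K & HK & ->).
- exists 1%nat, INR; split; [split; [reflexivity | split; [reflexivity |]] |].
  + intros k Hk; apply lt_INR; lia.
  + intros k Hk; replace k with 0%nat by lia; now apply regular_arc_C2_on; [simpl; lra |].
- rewrite Cl, (arc_curvature_smooth g 0 1 K HK Reg); ring.
Qed.

(** * Lower semicontinuity *)

Lemma difference_quotient (F : R -> E3) (x : R) (l : E3) (eps : R) :
  is_derive F x l -> 0 < eps ->
  exists delta, 0 < delta /\ forall y, y <> x -> Rabs (y - x) < delta ->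
    norm (minus (scal (/ (y - x)) (minus (F y) (F x))) l) < eps.
Proof.
intros D He; apply is_derive_iff in D.
destruct (proj1 (is_derive_within_iff _ _ x l I) D (eps / 2)) as (d & Pd & Hd); [lra |].
exists d; split; [exact Pd |]; intros y Ny Hy.
specialize (Hd y I Hy).
assert (Py : 0 < Rabs (y - x)) by (apply Rabs_pos_lt; lra).
apply Rle_lt_trans with (eps / 2); [| lra].
apply Rmult_le_reg_l with (Rabs (y - x)); [exact Py |].
rewrite <- norm_scal_E3, Rmult_comm.
replace (scal (y - x) _) with (minus (minus (F y) (F x)) (scal (y - x) l)); [exact Hd |].
assert (E : (y - x) * / (y - x) = 1) by (field; lra).
set (k := / (y - x)) in *; set (h := y - x) in *; set (u := minus (F y) (F x)).
assert (E' : u = scal (h * k) u) by (rewrite E; symmetry; apply (@scal_one R_Ring E3)).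
rewrite E' at 1; clearbody u k h; clear; vector_ring.
Qed.

Lemma converges_pointwise_eventually (Cs : nat -> R -> E3) (C : R -> E3) (t eps : R) :
  converges_pointwise Cs C -> 0 <= t <= 1 -> 0 < eps ->
  eventually (fun i => norm (minus (Cs i t) (C t)) < eps).
Proof.
intros Conv Ht He; specialize (Conv t Ht).
exact (proj1 (filterlim_locally_ball_norm _ _) Conv (mkposreal eps He)).
Qed.

(** The end tangents of [C] are approximated by secants from [a] and to [b]; with
these fixed, only four points of the curves [Cs i] have to converge. *)
Lemma arc_curvature_liminf_tangents (Cs : nat -> R -> E3) (C G H A : R -> E3) (a b eta : R) :
  converges_pointwise Cs C -> 0 <= a -> a < b -> b <= 1 ->
  arc_chart a b C G H A -> 0 < eta ->
  eventually (fun i => forall K, arc_curvature (Cs i) a b K -> angle (H a) (H b) - eta <= K).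
Proof.
intros Conv Ha Hab Hb Ch He.
assert (Na : H a <> zero) by (apply Ch; lra).
assert (Nb : H b <> zero) by (apply Ch; lra).
destruct (angle_continuous (H a) (H b) (eta / 2) Na Nb) as (d & Pd & Hd); [lra |].
destruct (difference_quotient G a (H a) d) as (da & Pda & Hda); [apply Ch; lra | exact Pd |].
destruct (difference_quotient G b (H b) d) as (db & Pdb & Hdb); [apply Ch; lra | exact Pd |].
set (h := Rmin ((b - a) / 3) (Rmin (da / 2) (db / 2))).
assert (Ph : 0 < h) by (repeat apply Rmin_pos; lra).
assert (h1 : h <= (b - a) / 3) by apply Rmin_l.
assert (h2 : h <= da / 2) by (eapply Rle_trans; [apply Rmin_r | apply Rmin_l]).
assert (h3 : h <= db / 2) by (eapply Rle_trans; [apply Rmin_r | apply Rmin_r]).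
set (p := a + h); set (q := b - h).
assert (Hp : a < p /\ p < q /\ q < b) by (unfold p, q; lra).
specialize (Hda p); specialize (Hdb q).
replace (p - a) with h in Hda by (unfold p; ring).
replace (q - b) with (- h) in Hdb by (unfold q; ring).
rewrite Rabs_Ropp in Hdb; rewrite Rabs_pos_eq in Hda, Hdb by lra.
assert (EG : forall t, a <= t <= b -> G t = C t) by (intros; now apply Ch).
rewrite !EG in Hda, Hdb by lra.
set (v := minus (C p) (C a)) in *; set (w := minus (C b) (C q)).
replace (scal (/ - h) (minus (C q) (C b))) with (scal (/ h) w) in Hdb.
2:{ rewrite Rinv_opp; unfold w; set (k := / h).
    set (x := C b); set (y := C q); clearbody k x y; clear; vector_ring. }
destruct (Hd (scal (/ h) v) (scal (/ h) w)) as (Nv & Nw & Hvw);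
  [apply Hda; lra | apply Hdb; lra |].
assert (Pk : 0 < / h) by now apply Rinv_0_lt_compat.
rewrite angle_scal_l, angle_scal_r in Hvw by exact Pk.
assert (Nv' : v <> zero) by (intros E; apply Nv; rewrite E; apply (@scal_zero_r R_Ring E3)).
assert (Nw' : w <> zero) by (intros E; apply Nw; rewrite E; apply (@scal_zero_r R_Ring E3)).
destruct (angle_continuous v w (eta / 2) Nv' Nw') as (e & Pe & Hee); [lra |].
assert (Close : forall s t, 0 <= s <= 1 -> 0 <= t <= 1 -> eventually (fun i =>
  norm (minus (minus (Cs i t) (Cs i s)) (minus (C t) (C s))) < e)).
{ intros s t Hs Ht.
  assert (Pe2 : 0 < e / 2) by lra.
  assert (F := filter_and _ _
    (converges_pointwise_eventually Cs C s _ Conv Hs Pe2)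
    (converges_pointwise_eventually Cs C t _ Conv Ht Pe2)).
  eapply filter_imp; [| exact F]; intros i [F1 F2].
  set (x := Cs i t) in *; set (y := Cs i s) in *; set (x' := C t) in *; set (y' := C s) in *.
  replace (minus (minus x y) (minus x' y')) with (minus (minus x x') (minus y y'))
    by (clearbody x y x' y'; clear; vector_ring).
  unfold minus at 1.
  eapply Rle_lt_trans; [apply (@norm_triangle R_AbsRing E3) |].
  rewrite norm_opp; lra. }
assert (Ca : eventually (fun i => norm (minus (minus (Cs i p) (Cs i a)) v) < e))
  by (apply Close; lra).
assert (Cb : eventually (fun i => norm (minus (minus (Cs i b) (Cs i q)) w) < e))
  by (apply Close; lra).
eapply filter_imp; [| exact (filter_and _ _ Ca Cb)].
intros i [F1 F2] K HK.
destruct (Hee _ _ F1 F2) as (N1 & N2 & B).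
assert (T : angle (minus (Cs i p) (Cs i a)) (minus (Cs i b) (Cs i q)) <= K)
  by (apply angle_two_chords; try assumption; lra).
apply Rabs_le_between in B, Hvw; lra.
Qed.

(** On short intervals the curvature of [C] is nearly the angle of its end
tangents; cutting at a point only drops a nonnegative exterior angle of [Cs i].
Half of [eps * (t - s)] pays for each of the two approximations. *)
Lemma arc_curvature_liminf (Cs : nat -> R -> E3) (C : R -> E3) (eps : R) :
  converges_pointwise Cs C -> regular_arc 0 1 C -> 0 < eps ->
  eventually (fun i => forall K, arc_curvature (Cs i) 0 1 K -> piece_curvature C 0 1 - eps <= K).
Proof.
intros Conv (G & H & A & Ch) He.
rewrite (piece_curvature_turning 0 1 C G H A Ch) by lra.
destruct (angle_turning_approx 0 1 C G H A Ch Rlt_0_1 (eps / 2)) as (d & Pd & Hd); [lra |].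
replace eps with (eps * (1 - 0)) by ring.
apply (interval_subdivision (fun s t => eventually (fun i => forall K,
  arc_curvature (Cs i) s t K -> RInt (turning_rate H A) s t - eps * (t - s) <= K)) 0 1 d);
  [lra | exact Pd | |].
- intros s t Hs Hst Ht L.
  assert (P : 0 < eps / 2 * (t - s)) by (apply Rmult_lt_0_compat; lra).
  eapply filter_imp;
    [| apply (arc_curvature_liminf_tangents Cs C G H A s t _ Conv Hs Hst Ht
         (arc_chart_sub 0 1 s t C G H A Hs Ht Ch) P)].
  intros i Hi K HK; specialize (Hi K HK).
  specialize (Hd s t Hs ltac:(lra) Ht L); apply Rabs_le_between in Hd; lra.
- intros s t u Hs Hst Htu Hu H1 H2.
  eapply filter_imp; [| exact (filter_and _ _ H1 H2)].
  intros i [I1 I2] K HK.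
  destruct (arc_curvature_split _ s t u K HK Hst Htu) as (K1 & K2 & A1 & A2 & ->).
  specialize (I1 K1 A1); specialize (I2 K2 A2).
  pose proof (angle_bound (left_derivative (Cs i) t) (right_derivative (Cs i) t)).
  rewrite <- (arc_RInt_Chasles 0 1 C G H A Ch s t u) by lra.
  unfold exterior_angle; lra.
Qed.

Theorem theorem5p3 :
  forall (C : R -> E3) (Cs : nat -> R -> E3),
    is_curve C -> regular_curve C -> C2_curve C -> simple_curve C ->
    (forall i : nat, is_curve (Cs i)) ->
    (forall i : nat, piecewise_C2 (Cs i)) ->
    (closed_curve C -> forall i : nat, closed_curve (Cs i)) ->
    converges_pointwise Cs C ->
    forall eps : R, 0 < eps ->
      exists N : nat, forall i : nat, (N <= i)%nat ->
        total_curvature (Cs i) > total_curvature C - eps.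
Proof.
intros C Cs _ Reg HC2 _ _ Pw _ Conv eps He.
destruct (regular_curve_chart C Reg HC2) as [Arc Cl].
rewrite (total_curvature_regular C Arc Cl).
destruct (arc_curvature_liminf Cs C (eps / 2) Conv Arc) as [N HN]; [lra |].
exists N; intros i Hi.
destruct (total_curvature_arc (Cs i) (Pw i)) as (K & HK & ->).
specialize (HN i Hi K HK); pose proof (closing_angle_ge_0 (Cs i)); lra.
Qed.
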